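(* Let $A \subseteq \mathbb{N}$ and write $A^c := \mathbb{N} \setminus A$. Let $\mathcal{M}$ be the set of all finitely additive probability measures $\mu : \mathcal{P}(\Omega) \to [0,1]$ satisfying the supertask constraint given in the context, and let $R : \Omega \to \mathbb{N}$ be the final-ball function. Then $$ \{ \mu(R \in A) \;:\; \mu \in \mathcal{M} \} = \begin{cases} \{0\} & \text{if } A \text{ is finite},\\ \{1\} & \text{if } A^c \text{ is finite},\\ [0,1] & \text{otherwise.} \end{cases} $$
   Context: $\mathbb{N} = \{1,2,3,\ldots\}$. For $k \in \mathbb{N}$ let $$\mathbb{N}_k := \{ A \subseteq \mathbb{N} : |A| = k \},$$ $$\Omega_k := \{ (B_k, B_{k+1}, \ldots) : B_j \in \mathbb{N}_j,\ B_j \subset B_{j+1} \text{ for all } j \ge k, \text{ and } \textstyle\bigcup_{j \ge k} B_j = \mathbb{N} \}.$$ The outcome space is $\Omega := \Omega_1$. For $B = (B_1, B_2, \ldots) \in \Omega$ with $B_1 = \{n\}$, define $$H_k(B) := (B_k, B_{k+1}, \ldots) \in \Omega_k, \qquad R(B) := n .$$ For $k \in \mathbb{N}$, $B = (B_{k+1}, B_{k+2}, \ldots) \in \Omega_{k+1}$, $S \subseteq \Omega_k$ and $1 \le j \le k+1$, set $$N(S;B) := |\{ b \in B_{k+1} : (B_{k+1} \setminus \{b\}, B_{k+1}, B_{k+2}, \ldots) \in S \}|,$$ $$P_j(S) := \{ B \in \Omega_{k+1} : N(S;B) = j \} \subseteq \Omega_{k+1}.$$ A probability function on $\Omega$ is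 a finitely additive probability measure $\mu : \mathcal{P}(\Omega) \to [0,1]$ defined on the full power set of $\Omega$: $\mu(\Omega) = 1$ and $\mu(E \cup F) = \mu(E) + \mu(F)$ for disjoint $E, F \subseteq \Omega$; $\sigma$-additivity is not required. As usual, $\mu(H_k \in S)$ denotes $\mu(\{B \in \Omega : H_k(B) \in S\})$, $\mu(R \in A)$ denotes $\mu(\{B \in \Omega : R(B) \in A\})$, and $\mu(E \mid F) := \mu(E \cap F)/\mu(F)$ when $\mu(F) > 0$. The supertask constraint on $\mu$ is: for every $k \in \mathbb{N}$, every $S \subseteq \Omega_k$, every $1 \le j \le k+1$ and every $T \subseteq P_j(S)$ such that $\mu(H_{k+1} \in T) > 0$, $$\mu(H_k \in S \mid H_{k+1} \in T) = \frac{j}{k+1}.$$ $\mathcal{M}$ is the set of all probability functions on $\Omega$ satisfying this constraint. The ambient set theory is ZFC. *)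

(* Defs.v *)
From mathcomp Require Import all_boot all_order all_algebra.
From mathcomp Require Import finmap.
From mathcomp Require Import all_classical all_reals.

Set Implicit Arguments.
Unset Strict Implicit.
Unset Printing Implicit Defensive.

Import Order.TTheory GRing.Theory Num.Theory.

Local Open Scope classical_set_scope.
Local Open Scope ring_scope.

(* The balls carry the labels 1, 2, 3, ... *)
Notation label := {n : nat | (0 < n)%N}.

(* A sequence (B_k, B_(k+1), ...) is stored from index 0, so that
   B i stands for B_(k + i). The inclusions in Omega k are automatically
   proper because the cardinalities differ. *)
Definition fset_seq : Type := nat -> {fset label}.

Definition Omega (k : nat) : set fset_seq :=
  [set B | [/\ forall i, #|` B i| = (k + i)%N,
               forall i, (B i `<=` B i.+1)%fset
             & \bigcup_i [set` B i] = [set: label] ] ].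

(* Elements of Omega 1 start at B_1, hence the index shift by k - 1;
   only meaningful for 0 < k. *)
Definition tail (k : nat) (B : fset_seq) : fset_seq :=
  fun i => B (k.-1 + i)%N.

(* The sequence (B_(k+1) \ {b}, B_(k+1), B_(k+2), ...) for B = (B_(k+1), B_(k+2), ...). *)
Definition put_back (b : label) (B : fset_seq) : fset_seq :=
  fun i => if i is i'.+1 then B i' else (B 0%N `\ b)%fset.

Definition num_back (S : set fset_seq) (B : fset_seq) : nat :=
  #|` [fset b in B 0%N | put_back b B \in S]%fset|.

Definition put_back_level (k j : nat) (S : set fset_seq) : set fset_seq :=
  [set B | Omega k.+1 B /\ num_back S B = j].

Lemma final_ball_subproof (B : Omega 1) : exists n, val B 0%N = [fset n]%fset.
Proof.
have [cB _ _] := set_mem (valP B).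
by apply/cardfs1P; rewrite cB.
Qed.

Definition final_ball (B : Omega 1) : label :=
  projT1 (cid (final_ball_subproof B)).

Section probability_functions.
Variable R : realType.

Definition probability_function (T : Type) (mu : set T -> R) : Prop :=
  [/\ forall E, 0 <= mu E <= 1,
      mu [set: T] = 1
    & forall E F, E `&` F = set0 -> mu (E `|` F) = mu E + mu F].

(* Only used when 0 < mu F. *)
Definition cond_prob (T : Type) (mu : set T -> R) (E F : set T) : R :=
  mu (E `&` F) / mu F.

(* The event H_k \in S. *)
Definition tail_in (k : nat) (S : set fset_seq) : set (Omega 1) :=
  [set B | S (tail k (val B))].

Definition supertask_constraint (mu : set (Omega 1) -> R) : Prop :=
  forall (k : nat) (S : set fset_seq) (j : nat) (T : set fset_seq),
    (0 < k)%N -> S `<=` Omega k -> (1 <= j <= k.+1)%N -> T `<=` put_back_level k j S ->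
    0 < mu (tail_in k.+1 T) ->
    cond_prob mu (tail_in k S) (tail_in k.+1 T) = j%:R / k.+1%:R.

Definition supertask_measures : set (set (Omega 1) -> R) :=
  [set mu | probability_function mu /\ supertask_constraint mu].

End probability_functions.

(* Main.v *)
(* Necessity: conditionally on the ball l being among the last k+1 balls, it is
   among the last k with probability k/(k+1), so R = l has probability at most
   1/k for every k, hence 0.
   Existence: start the time-reversed supertask at a fixed sequence C n of
   Omega n.+1, i.e. remove from B_(n+1), B_n, ... one uniformly chosen ball after
   another. This gives a finitely supported probability function which satisfies
   the constraint at all levels k <= n and under which R is uniform on the n+1
   balls of C n 0. A limit along a nonprincipal ultrafilter satisfies the constraint
   at all levels and gives R \in A the limit of the proportions of A in C n 0; if
   A and its complement are infinite, these can be chosen to converge to any p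
   in [0, 1]. *)
Require Import Defs.
From mathcomp Require Import all_boot all_order all_algebra.
From mathcomp Require Import finmap.
From mathcomp Require Import all_classical all_reals all_analysis.

Import Order.TTheory GRing.Theory Num.Theory.
Import numFieldNormedType.Exports.

Local Open Scope classical_set_scope.
Local Open Scope ring_scope.

(** * Finitely additive probability functions and their ultrafilter limits *)

Lemma ultra_fmap (T U : Type) (f : T -> U) (F : set_system T) :
  UltraFilter F -> UltraFilter (f @ F).
Proof.
move=> FU; split=> [|G GF fFG]; first exact: fmap_proper_filter.
apply/seteqP; split => // A GA.
have [//|FnA] := in_ultra_setVsetC (f @^-1` A) FU.
have GnA : G (~` A) by exact: fFG.
by have [x []] := filter_ex (filterI GA GnA).
Qed.

Lemma sum_fset_mem (T : choiceType) (A : {fset T}) (P : pred T) :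
  (\sum_(x <- A) P x)%N = #|` [fset x in A | P x]%fset|.
Proof.
rewrite card_fset_sum1 -big_fset_condE [RHS]big_mkcond.
by apply: eq_bigr => x _; case: ifP.
Qed.

Section finitely_additive.
Context {R : realType} {T : Type}.
Implicit Types (mu : set T -> R) (E F : set T).

Lemma probability_function_of_ge0 mu :
  (forall E, 0 <= mu E) -> mu [set: T] = 1 ->
  (forall E F, E `&` F = set0 -> mu (E `|` F) = mu E + mu F) ->
  probability_function mu.
Proof.
move=> mu_ge0 muT muU; split => // E; rewrite mu_ge0 /= -muT -(setUv E).
by rewrite muU ?setICr// lerDl.
Qed.

Lemma probability_function_le mu E F :
  probability_function mu -> E `<=` F -> mu E <= mu F.
Proof.
move=> [mu01 _ muU] /setDUK <-.
by rewrite muU ?setDIK// lerDl; have /andP[] := mu01 (F `\` E).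
Qed.

Lemma probability_function_setU_le mu E F :
  probability_function mu -> mu (E `|` F) <= mu E + mu F.
Proof.
move=> Pmu; have [_ _ muU] := Pmu.
have -> : E `|` F = E `|` (F `\` E) by rewrite setDE setUIr setUv setIT.
rewrite muU ?setDIK// lerD2l; apply: probability_function_le Pmu _.
exact: subDsetl.
Qed.

Lemma probability_function_setC mu E :
  probability_function mu -> mu (~` E) = 1 - mu E.
Proof.
by move=> [_ muT muU]; rewrite -muT -(setUv E) muU ?setICr// addrC addKr.
Qed.

Lemma probability_function_set0 mu :
  probability_function mu -> mu set0 = 0.
Proof.
move=> Pmu; have [_ muT _] := Pmu.
by rewrite -setCT probability_function_setC// muT subrr.
Qed.

(** Every sequence [nu n E] lives in the compact interval [0, 1], so it converges along [U];
    nonnegativity, total mass and additivity survive the pointwise limit, which sigma-additivity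
    need not. *)
Lemma probability_function_ultralimit (U : set_system nat)
    (nu : nat -> set T -> R) : UltraFilter U ->
  (forall n, probability_function (nu n)) ->
  exists2 mu, probability_function mu & forall E, nu n E @[n --> U] --> mu E.
Proof.
move=> UU Pnu.
have /choice[mu mu_lim] E : exists l : R, nu n E @[n --> U] --> l.
  have := @segment_compact R 0 1; rewrite compact_ultra => cpct.
  have nu01 : (nu ^~ E @ U) `[0, 1]%classic.
    apply: (@filterS _ U _ setT); last exact: filterT.
    by move=> n _; have [nuE01 _ _] := Pnu n; rewrite /= in_itv nuE01.
  by have [l [_ ?]] := cpct _ (ultra_fmap _ _ _ _ UU) nu01; exists l.
exists mu => //; apply: probability_function_of_ge0 => [E||E F EF0].
- apply: (closed_cvg (fun x : R => 0 <= x)) (mu_lim E); first exact: closed_ge.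
  by apply: nearW => n; have [/(_ E)/andP[] //] := Pnu n.
- have nuT : nu ^~ [set: T] = cst 1 by apply/funext => n; have [] := Pnu n.
  have := mu_lim [set: T]; rewrite nuT => lim_muT.
  by apply: (cvg_unique _ lim_muT) => //; exact: cvg_cst.
- have nuU : nu ^~ (E `|` F) = nu ^~ E \+ nu ^~ F.
    by apply/funext => n; have [_ _ ->] := Pnu n.
  have := mu_lim (E `|` F); rewrite nuU => lim_muU.
  by apply: (cvg_unique _ lim_muU) => //; exact: cvgD.
Qed.

End finitely_additive.

(** * The reversed supertask as an averaging operator *)

Lemma put_back_Omega k b B :
  Omega k.+1 B -> b \in B 0%N -> Omega k (put_back b B).
Proof.
move=> [cB sB UB] bB; split => [[|i]|[|i]|] /=.
- have := cardfsD1 b (B 0%N).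
  by rewrite cB bB addn0 add1n => -[<-]; rewrite addn0.
- by rewrite cB addnS.
- exact: fsubD1set.
- exact: sB.
- rewrite -subTset => l _.
  have [i _ Bil] : (\bigcup_i [set` B i]) l by rewrite UB.
  by exists i.+1.
Qed.

Section backward_averages.
Context {R : realType}.
Implicit Types (f g : fset_seq -> R) (S T : set fset_seq).

(* The expectation of [f] after one step of the time-reversed supertask. *)
Definition average f : fset_seq -> R :=
  fun B => (\sum_(b <- B 0%N) f (put_back b B)) / #|` B 0%N|%:R.

Lemma eq_average k f g :
  {in Omega k, f =1 g} -> {in Omega k.+1, average f =1 average g}.
Proof.
move=> fg B /set_mem OB; congr (_ / _); apply: eq_big_seq => b bB.
by apply/fg/mem_set/put_back_Omega.
Qed.

(** Each [put_back] lowers the level by one, so [m] averages taken at level [m + k] evaluate the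
    function on [Omega k] only. *)
Lemma eq_iter_average m k f g :
  {in Omega k, f =1 g} ->
  {in Omega (m + k), iter m average f =1 iter m average g}.
Proof. by elim: m => // m IHm fg; apply/eq_average/IHm. Qed.

Lemma averageD f g :
  average (fun B => f B + g B) = (fun B => average f B + average g B).
Proof. by apply/funext => B; rewrite /average big_split mulrDl. Qed.

Lemma averageZ c f : average (fun B => c * f B) = (fun B => c * average f B).
Proof. by apply/funext => B; rewrite /average -mulr_sumr mulrA. Qed.

Lemma iter_averageD m f g :
  iter m average (fun B => f B + g B) =
  (fun B => iter m average f B + iter m average g B).
Proof. by elim: m => //= m ->; exact: averageD. Qed.

Lemma iter_averageZ m c f :
  iter m average (fun B => c * f B) = (fun B => c * iter m average f B).
Proof. by elim: m => //= m ->; exact: averageZ. Qed.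

Lemma iter_average_ge0 m f :
  (forall B, 0 <= f B) -> forall B, 0 <= iter m average f B.
Proof.
move=> f_ge0; elim: m => //= m IHm B.
by rewrite /average mulr_ge0 ?invr_ge0// sumr_ge0.
Qed.

(** [tail 2] deletes the entry that [put_back] has just added, so a constant is averaged, over a set
    that is nonempty at level [k.+1]. *)
Lemma average_tail2 k g :
  {in Omega k.+1, average (fun B => g (tail 2 B)) =1 g}.
Proof.
move=> B /set_mem[cB _ _]; rewrite /average -[X in X / _]/(\sum_(b <- B 0%N) g B).
rewrite big_const_seq count_predT iter_addr_0 -[g B *+ _]mulr_natr.
by rewrite mulfK// cB pnatr_eq0.
Qed.

Lemma iter_average_tail k g :
  {in Omega k.+1, iter k average (fun B => g (tail k.+1 B)) =1 g}.
Proof.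
elim: k g => [//|k IHk] g B OB.
rewrite iterS -[RHS](average_tail2 k.+1 g _ OB); apply: eq_average OB => B' OB'.
rewrite -(IHk (fun B => g (tail 2 B)) _ OB'); congr (iter k _ _ B').
by apply/funext => B2; congr g; apply/funext => i; rewrite /tail/= add1n addnS.
Qed.

Lemma sum_put_back S (B : fset_seq) :
  \sum_(b <- B 0%N) (put_back b B \in S)%:R = (num_back S B)%:R :> R.
Proof.
by rewrite -natr_sum sum_fset_mem.
Qed.

(** This is the constraint with its denominator cleared. The [k] innermost averages do not affect
    the integrand, the next one produces [num_back S B] over [k.+2], and the [m] outermost ones are
    linear. *)
Lemma iter_average_supertask k j m S T : T `<=` put_back_level k.+1 j S ->
  {in Omega (m + k.+2),
    iter (m + k.+1) average
      (fun B => (tail k.+1 B \in S)%:R * (tail k.+2 B \in T)%:R) =1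
    (fun B => j%:R / k.+2%:R *
      iter (m + k.+1) average (fun B' => (tail k.+2 B' \in T)%:R) B)}.
Proof.
move=> TS C OC; rewrite !iterD.
transitivity (iter m average (fun B => j%:R / k.+2%:R *
    iter k.+1 average (fun B' => (tail k.+2 B' \in T)%:R) B) C);
  last by rewrite iter_averageZ.
apply: eq_iter_average OC => B OB.
rewrite (iter_average_tail _ (fun B => (B \in T)%:R))//.
transitivity (average (fun B => (B \in S)%:R * (tail 2 B \in T)%:R) B).
  (* Since [tail k.+2] is [tail 2] of [tail k.+1], the integrand is a function of [tail k.+1]
     alone. *)
  rewrite iterS; apply: eq_average OB => B' OB'.
  rewrite -(iter_average_tail _
    (fun B => (B \in S)%:R * (tail 2 B \in T)%:R) _ OB').
  congr (iter k _ _ B').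
  apply/funext => B2; congr (_ * (_ \in T)%:R).
  by apply/funext => i; rewrite /tail/= add1n addnS.
rewrite /average.
rewrite -[X in X / _ = _]/(\sum_(b <- B 0%N)
  (put_back b B \in S)%:R * (B \in T)%:R).
rewrite -mulr_suml sum_put_back.
have [cB _ _] := set_mem OB; rewrite cB addn0.
(* On [T] the count is [j]; off [T] both sides vanish. *)
have [/set_mem/TS[_ ->]|] := boolP (B \in T); first by rewrite !mulr1.
by move=> _; rewrite !mulr0 mul0r.
Qed.
End backward_averages.

(** * The proportion of balls in [A] is harmonic for the averaging *)

Section final_fraction.
Context {R : realType}.
Implicit Types (A : set label).

Definition fraction A : fset_seq -> R :=
  fun B => #|` [fset a in B 0%N | a \in A]%fset|%:R / #|` B 0%N|%:R.

(** If [a] of the k+2 balls lie in [A], deleting each ball in turn leaves numerators that sum to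
    (k+2)a - a = (k+1)a. Starting at level [k.+2] keeps the smaller sets nonempty. *)
Lemma average_fraction k A :
  {in Omega k.+2, average (fraction A) =1 fraction A}.
Proof.
move=> B /set_mem OB; have [cB _ _] := OB.
rewrite /average {2}/fraction; congr (_ / _).
have natSr0 : k.+1%:R != 0 :> R by rewrite pnatr_eq0.
set a := #|` [fset a in B 0%N | a \in A]%fset|.
transitivity (\sum_(b <- B 0%N) (a%:R - (b \in A)%:R) / k.+1%:R : R).
  apply: eq_big_seq => b bB; rewrite /fraction.
  have [-> _ _] := put_back_Omega _ _ _ OB bB; rewrite addn0; congr (_ / _).
  apply/esym/eqP; rewrite subr_eq -natrD; apply/eqP; congr (_%:R).
  rewrite /a (cardfsD1 b) !inE /= bB /= addnC; congr (_ + _)%N.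
  by congr (#|` _|); apply/fsetP => x; rewrite !inE /= andbA.
rewrite -mulr_suml sumrB big_const_seq count_predT iter_addr_0.
rewrite -natr_sum -[size _]/(#|` B 0%N|) cB addn0.
rewrite sum_fset_mem -/a.
by rewrite [a%:R *+ _]mulrSr addrK -[a%:R *+ _]mulr_natr mulfK.
Qed.

Lemma iter_average_fraction m k A :
  {in Omega (m + k.+1), iter m average (fraction A) =1 fraction A}.
Proof.
elim: m => [//|m IHm] C OC; rewrite iterS (eq_average _ _ _ IHm _ OC).
by move: OC; rewrite addSn addnS; exact: average_fraction.
Qed.

(** With a single ball left, the proportion is the indicator of that ball lying in [A]; this ties
    events on [final_ball] to [fraction A]. *)
Lemma fraction_final A (B : fset_seq) : B \in Omega 1 ->
  (B \in [set val B' | B' in final_ball @^-1` A])%:R = fraction A B.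
Proof.
move=> OB; pose B' : Omega 1 := SigSub OB.
have -> : B = val B' by [].
have -> : (val B' \in [set val B' | B' in final_ball @^-1` A]) =
    (final_ball B' \in A).
  apply/idP/idP => [/set_mem[B2 AB2 /val_inj <-]|/set_mem AB'].
    exact/mem_set.
  by apply/mem_set; exists B'.
rewrite /final_ball /fraction; case: cid => n /= ->; rewrite cardfs1 divr1.
have [nA|nA] := boolP (n \in A).
  rewrite (_ : [fset a in _ | _]%fset = [fset n]%fset) ?cardfs1//.
  by apply/fsetP => x; rewrite !inE /=; case: eqVneq => // ->; rewrite nA.
rewrite (_ : [fset a in _ | _]%fset = fset0) ?cardfs0//.
apply/fsetP => x; rewrite !inE /=; case: eqVneq => // ->.
by rewrite (negbTE nA).
Qed.
End final_fraction.

(** * A finite set of final balls has measure zero *)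

Section necessity.
Context {R : realType} {mu : set (Omega 1) -> R}.
Hypothesis mu_supertask : supertask_measures mu.

Lemma tail_Omega k B : Omega 1 B -> Omega k.+1 (tail k.+1 B).
Proof.
move=> [cB sB UB]; split => [i|i|].
- by rewrite cB add1n addSn.
- by rewrite /tail addnS; exact: sB.
- rewrite -subTset => l _.
  have [i _ Bil] : (\bigcup_i [set` B i]) l by rewrite UB.
  exists i => //; rewrite /tail /=; elim: k => [//|k IHk].
  exact: (fsubsetP (sB _)) IHk.
Qed.

Definition contains_label (l : label) (k : nat) : set fset_seq :=
  [set B | Omega k B /\ l \in B 0%N].

(** Deleting [b] keeps [l] exactly when [b] differs from [l], which holds for k+1 of the k+2
    balls. *)
Lemma put_back_contains_label l k :
  contains_label l k.+2 `<=` put_back_level k.+1 k.+1 (contains_label l k.+1).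
Proof.
move=> B [OB lB]; split => //; have [cB _ _] := OB.
have := cardfsD1 l (B 0%N); rewrite lB cB addn0 add1n => -[kE].
rewrite /num_back [RHS]kE; congr (#|` _|); apply/fsetP => b; rewrite !inE /=.
have [bB|] := boolP (b \in B 0%N); last by rewrite andbF.
rewrite andbT; apply/idP/idP => [/set_mem[_]|bl].
  by rewrite /= !inE eq_sym => /andP[].
apply/mem_set; split; first exact: put_back_Omega.
by rewrite /= !inE eq_sym bl.
Qed.

Lemma measure_contains_label l k :
  mu (tail_in k.+1 (contains_label l k.+1)) =
  k.+1%:R / k.+2%:R * mu (tail_in k.+2 (contains_label l k.+2)).
Proof.
have [Pmu constraint] := mu_supertask; have [mu01 _ _] := Pmu.
set E := tail_in k.+1 _; set F := tail_in k.+2 _.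
have EF : E `<=` F.
  move=> B [_ lB]; split; first exact/tail_Omega/set_mem/valP.
  have [_ /(_ k)/fsubsetP sB _] := set_mem (valP B).
  by move: lB; rewrite /tail/= !addn0; exact: sB.
(* The constraint is silent when [F] is null, but then its subset [E] is null too. *)
have := mu01 F; rewrite le_eqVlt => /andP[/predU1P[F0 _|F0 _]].
  have := probability_function_le _ _ _ Pmu EF; rewrite -F0 mulr0 => E_le0.
  apply/eqP; rewrite eq_le E_le0.
  by have /andP[] := mu01 E.
have <- : cond_prob mu E F = k.+1%:R / k.+2%:R.
  apply: constraint; rewrite ?ltnS ?leqnSn//; first by move=> B [].
  exact: put_back_contains_label.
by rewrite /cond_prob (setIidl EF) divfK// gt_eqF.
Qed.

Lemma measure_final_ball_eq (l : label) : mu (final_ball @^-1` [set l]) = 0.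
Proof.
have [[mu01 muT muU] _] := mu_supertask.
have -> : final_ball @^-1` [set l] = tail_in 1 (contains_label l 1).
  apply/seteqP; split => B;
    rewrite /tail_in /contains_label /final_ball /preimage /=;
    case: cid => n /= B0; rewrite /tail /= B0 !inE.
    by move=> ->; split => //; apply: (tail_Omega 0 _ (set_mem (valP B))).
  by move=> [_ /eqP].
(* The factors (k+1)/(k+2) telescope. *)
have bound k : mu (tail_in 1 (contains_label l 1)) =
    mu (tail_in k.+1 (contains_label l k.+1)) / k.+1%:R.
  elim: k => [|k ->]; first by rewrite divr1.
  rewrite measure_contains_label mulrC !mulrA mulVf ?pnatr_eq0//.
  by rewrite mul1r mulrC.
set x := mu _ in bound *; have /andP[x_ge0 _] : 0 <= x <= 1 by exact: mu01.
apply/eqP; rewrite eq_le x_ge0 andbT leNgt; apply/negP => x_gt0.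
(* With m the integer part of 1/x, a positive x would exceed 1/(m+1), against [bound m]. *)
have /andP[_] : (Num.truncn x^-1)%:R <= x^-1 < (Num.truncn x^-1).+1%:R.
  by rewrite truncn_itv// invr_ge0.
move: (Num.truncn _) => m; rewrite invf_plt ?posrE// ltNge => /negP; apply.
rewrite (bound m) ler_pdivrMr// mulVf ?pnatr_eq0//.
by have /andP[] := mu01 (tail_in m.+1 (contains_label l m.+1)).
Qed.

Lemma measure_final_ball_finite (A : set label) :
  finite_set A -> mu (final_ball @^-1` A) = 0.
Proof.
have [Pmu _] := mu_supertask; have [mu01 _ muU] := Pmu.
move=> /finite_seqP[s ->]; elim: s => [|l s IHs].
  by rewrite set_nil preimage_set0 probability_function_set0.
have -> : [set` l :: s] = [set l] `|` [set` s].
  by apply/seteqP; split => x /=; rewrite in_cons => /predU1P.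
rewrite preimage_setU.
set E := _ `|` _; apply/eqP; rewrite eq_le; have /andP[-> _] := mu01 E.
rewrite andbT (le_trans (probability_function_setU_le _ _ _ Pmu))//.
by rewrite IHs measure_final_ball_eq addr0.
Qed.
End necessity.

(** * Reversed supertasks from fixed starts, and their limit *)

Section existence.
Context {R : realType}.

(** Averages act on raw sequences, so an event on the subtype [Omega 1] enters through its image
    under [val]. It is meant for [C] at level [m.+1], from which [m] steps lead to level 1. *)
Definition backward_measure (m : nat) (C : fset_seq) (E : set (Omega 1)) : R :=
  iter m average (fun B => (B \in [set val B' | B' in E])%:R) C.

Lemma backward_measure_eq m C E (f : fset_seq -> R) : Omega m.+1 C ->
  (forall B : Omega 1, (B \in E)%:R = f (val B)) ->
  backward_measure m C E = iter m average f C.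
Proof.
rewrite -addn1 => /mem_set OC Ef; apply: eq_iter_average OC => B OB.
rewrite -[B]/(val (SigSub OB : Omega 1)) -Ef; congr (nat_of_bool _)%:R.
apply/idP/idP => /set_mem => [[B' EB' /val_inj <-]|EB].
  exact/mem_set.
by apply/mem_set; eexists; first exact: EB.
Qed.

Lemma backward_measure_probability m C :
  Omega m.+1 C -> probability_function (backward_measure m C).
Proof.
move=> OC; apply: probability_function_of_ge0 => [E||E F EF0].
- exact: iter_average_ge0.
- rewrite (backward_measure_eq _ _ _ (fun=> 1) OC) => [|B]; last by rewrite in_setT.
  exact: (iter_average_tail m (fun=> 1) _ (mem_set OC)).
- rewrite /backward_measure image_setU -[RHS]/((fun B => _ + _) C) -iter_averageD.
  congr (iter m average _ C); apply/funext => B; rewrite in_setU.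
  have [/set_mem[B1 EB1 <-]|] := boolP (B \in _ @` E); last by rewrite add0r.
  case: (boolP (_ \in _ @` F)) => [/set_mem[B2 FB2 /val_inj B21]|];
    last by rewrite addr0.
  by have : (E `&` F) B1; [split => //; rewrite -B21|rewrite EF0].
Qed.

(** The bound on [k] puts level k+2 at or below the starting level m+1, so the reversed step from
    level k+2 to k+1 really takes place. *)
Lemma backward_measure_supertask m k j C S T : Omega m.+1 C -> (k < m)%N ->
  T `<=` put_back_level k.+1 j S ->
  backward_measure m C (tail_in k.+1 S `&` tail_in k.+2 T) =
  j%:R / k.+2%:R * backward_measure m C (tail_in k.+2 T).
Proof.
move=> OC /subnK mE TS.
rewrite (backward_measure_eq _ _ _
  (fun B => (tail k.+1 B \in S)%:R * (tail k.+2 B \in T)%:R) OC); last first.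
  by move=> B; rewrite in_setI -natrM mulnb.
rewrite (backward_measure_eq _ _ _ (fun B => (tail k.+2 B \in T)%:R) OC)//.
by rewrite -mE; apply: iter_average_supertask => //; rewrite addnS mE mem_set.
Qed.

Lemma supertask_measure_exists (C : nat -> fset_seq) :
  (forall n, Omega n.+1 (C n)) ->
  exists2 mu : set (Omega 1) -> R, supertask_measures mu &
    forall A p, fraction A (C n) @[n --> \oo] --> p ->
      mu (final_ball @^-1` A) = p.
Proof.
move=> OC; have [U [UU ooU]] := ultraFilterLemma (eventually_filter).
pose nu n := backward_measure n (C n).
have Pnu n : probability_function (nu n) by exact: backward_measure_probability.
have [mu Pmu mu_lim] := probability_function_ultralimit _ _ UU Pnu.
exists mu => [|A p]; last first.
  have -> : (fun n => fraction A (C n)) = nu ^~ (final_ball @^-1` A).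
    apply/funext => n.
    rewrite /nu (backward_measure_eq _ _ _ (fraction A) (OC n)) => [|B].
      by apply/esym/(iter_average_fraction n 0); rewrite addn1 mem_set.
    rewrite -fraction_final; last exact: valP.
    congr (nat_of_bool _)%:R.
    apply/idP/idP => /set_mem => [EB|[B' EB' /val_inj <-]].
      by apply/mem_set; exists B.
    exact/mem_set.
  (* [U] refines the filter of cofinite sets, so an ordinary limit is also the limit along [U]. *)
  move=> lim_p; apply: (cvg_unique _ (mu_lim _)) => //.
  by apply: cvg_trans lim_p; apply: cvg_app ooU.
split => // -[//|k] S j T _ SO jk TS T_gt0.
(* In product form the constraint is an equation between two limits along [U]. *)
rewrite /cond_prob; apply: (canLR (mulfK _)); first by rewrite gt_eqF.
apply: (cvg_unique _ (mu_lim _)) => //.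
have : j%:R / k.+2%:R * nu n (tail_in k.+2 T) @[n --> U] -->
    j%:R / k.+2%:R * mu (tail_in k.+2 T).
  exact: cvgMr.
(* The equation holds for [nu n] only once n > k, which is enough because [U] contains every
   cofinite set. *)
apply: cvg_trans; apply: near_eq_cvg; apply: ooU; exists k.+1 => // n /= kn.
by rewrite /nu (backward_measure_supertask _ _ _ _ _ _ _ _ TS).
Qed.
End existence.

(** * Starting sequences with a prescribed proportion *)

Lemma infinite_set_fset_card (T : choiceType) (A : set T) n : infinite_set A ->
  exists2 D : {fset T}, [set` D] `<=` A & #|` D| = n.
Proof.
move=> /(infinite_set_fset n)[B BA nB].
exists [fset x in take n (enum_fset B)]%fset.
  by move=> x /=; rewrite inE => /mem_take xB; exact: BA.
by rewrite card_fseq undup_id ?take_uniq ?fset_uniq// size_takel.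
Qed.

Lemma infinite_label : infinite_set [set: label].
Proof.
pose succ n : label := exist _ n.+1 (ltn0Sn n).
have succ_inj : {in [set: nat] &, injective succ} by move=> m n _ _ [].
by apply/infiniteP; rewrite -(card_le_eql (inj_card_eq succ_inj)) card_leT.
Qed.

(** The complement of [D] is countably infinite; its labels are enumerated by [e] and joined to [D]
    one at a time. *)
Lemma Omega_extension (D : {fset label}) :
  exists2 C, Omega #|` D| C & C 0%N = D.
Proof.
have /card_bijP[f [g fK gK]] : (~` [set` D] #= [set: nat])%card.
  apply: eq_card_nat; first exact: (@countableP label).
  rewrite -setTD.
  exact: (infinite_setD infinite_label (finite_fset D)).
pose e n : label := val (g (SigSub (mem_set (I : [set: nat] n)))).
have eD n : e n \notin D by apply/negP; exact: (set_mem (valP (g _))).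
have e_inj : injective e by move=> m n /val_inj/(can_inj gK) [].
have e_surj l : l \notin D -> exists n, e n = l.
  move=> /negP lD; have := fK (SigSub (mem_set (lD : (~` [set` D]) l))).
  case: (f _) => n nT /(congr1 val) /= <-; exists n.
  by rewrite /e; congr (val (g _)); exact: val_inj.
have mem_e n i : (e n \in [fset e n | n in iota 0 i]%fset) = (n < i)%N.
  by rewrite mem_imfset//= mem_iota.
exists (fun i => D `|` [fset e n | n in iota 0 i])%fset; last first.
  by apply/fsetP => l; rewrite inE; case: (_ \in D) => //=; apply/imfsetP => -[].
split => [i|i|].
- rewrite cardfsU (_ : D `&` _ = fset0)%fset ?cardfs0 ?subn0; last first.
    apply/fsetP => l; rewrite !inE; apply/andP => -[lD /imfsetP[n _ ln]].
    by move: (eD n); rewrite -ln lD.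
  by rewrite card_imfset//= undup_id ?iota_uniq// size_iota.
- apply: fsetUS; apply/fsubsetP => l /imfsetP[n /= n_i ->].
  by apply: (etrans (mem_e n i.+1)); move: n_i; rewrite mem_iota => /leqW.
- rewrite -subTset => l _; have [lD|/e_surj[n <-]] := boolP (l \in D).
    by exists 0%N => //=; rewrite inE lD.
  by exists n.+1 => //; rewrite /mkset inE mem_e ltnSn orbT.
Qed.

(** Truncation loses less than 1, so the quotient lies between p - 1/(n+1) and p. *)
Lemma cvg_truncn_fraction (R : realType) (p : R) : 0 <= p ->
  (Num.truncn (p * n.+1%:R))%:R / n.+1%:R @[n --> \oo] --> p.
Proof.
move=> p_ge0; apply: (@squeeze_cvgr _ _ _ _ (fun n => p - harmonic n) (cst p)).
- apply: nearW => n /=.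
  have /andP[lo hi] : (Num.truncn (p * n.+1%:R))%:R <= p * n.+1%:R
      < (Num.truncn (p * n.+1%:R)).+1%:R.
    by rewrite truncn_itv// mulr_ge0.
  rewrite ler_pdivlMr// ler_pdivrMr// lo andbT mulrBl mulVf ?pnatr_eq0//.
  by rewrite lerBlDr natr1 ltW.
- by rewrite -[X in _ --> X]subr0; apply: cvgB; [exact: cvg_cst|exact: cvg_harmonic].
- exact: cvg_cst.
Qed.

(** The first set consists of [a] labels from [A] and [n - a] from its complement. *)
Lemma Omega_with_fraction (R : realType) (A : set label) n a :
  infinite_set A -> infinite_set (~` A) -> (a <= n)%N ->
  exists2 C, Omega n C & fraction A C = a%:R / n%:R :> R.
Proof.
move=> /(infinite_set_fset_card _ _ a)[D DA cD].
move=> /(infinite_set_fset_card _ _ (n - a))[D' D'A cD'] a_n.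
have [C OC C0] := Omega_extension (D `|` D')%fset.
have DD' : (D `&` D' = fset0)%fset.
  apply/fsetP => l; rewrite !inE; apply/andP => -[/DA Al /D'A]; exact.
have cDD' : #|` (D `|` D')%fset| = n.
  by rewrite cardfsU DD' cardfs0 subn0 cD cD' subnKC.
exists C; first by rewrite -cDD'.
rewrite /fraction C0 cDD' -cD; congr (_%:R / _); congr (#|` _|).
apply/fsetP => l; rewrite !inE /=.
have [/DA Al|_] /= := boolP (l \in D); first exact/mem_set.
by apply/andP => -[/D'A Al /set_mem].
Qed.

Theorem theorem1 (R : realType) (A : set label) :
  [/\ finite_set A ->
        [set mu (final_ball @^-1` A) | mu in @supertask_measures R] = [set 0],
      finite_set (~` A) ->
        [set mu (final_ball @^-1` A) | mu in @supertask_measures R] = [set 1]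
    & ~ finite_set A -> ~ finite_set (~` A) ->
        [set mu (final_ball @^-1` A) | mu in @supertask_measures R]
          = `[0, 1]%classic].
Proof.
(* Equality with a singleton in the finite and cofinite cases requires at least one measure; any
   starting sequences provide it. *)
have [mu0 mu0_supertask] : exists mu : set (Omega 1) -> R, supertask_measures mu.
  have /choice[C OC] n : exists C, Omega n.+1 C.
    have [D _ cD] := infinite_set_fset_card _ _ n.+1 infinite_label.
    by have [C OC _] := Omega_extension D; exists C; rewrite -cD.
  by have [mu ? _] := @supertask_measure_exists R C OC; exists mu.
have measure1 (mu : set (Omega 1) -> R) : supertask_measures mu ->
    finite_set (~` A) -> mu (final_ball @^-1` A) = 1.
  move=> mu_supertask /(measure_final_ball_finite mu_supertask).
  rewrite preimage_setC probability_function_setC; last by case: mu_supertask.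
  by move=> /eqP; rewrite subr_eq0 => /eqP.
split => [finA|cofinA|infA coinfA].
- apply/seteqP; split => [_ [mu mu_supertask <-]|_ ->].
    exact: measure_final_ball_finite.
  by exists mu0 => //; exact: measure_final_ball_finite.
- apply/seteqP; split => [_ [mu mu_supertask <-]|_ ->]; first exact: measure1.
  by exists mu0 => //; exact: measure1.
apply/seteqP; split => [_ [mu [[mu01 _ _] _] <-]|p /=].
  by rewrite /= in_itv /= mu01.
rewrite in_itv /= => /andP[p_ge0 p_le1].
(* The largest number of balls out of n+1 whose proportion does not exceed [p]. *)
pose a n := Num.truncn (p * n.+1%:R).
have /choice[C OC] n :
    exists C, Omega n.+1 C /\ fraction A C = (a n)%:R / n.+1%:R :> R.
  have a_n : (a n <= n.+1)%N.
    rewrite -(ler_nat R); apply: (@le_trans _ _ (p * n.+1%:R)).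
      by rewrite truncn_le mulr_ge0.
    by rewrite ler_piMl.
  by have [C] := Omega_with_fraction R A _ _ infA coinfA a_n; exists C.
have [|mu mu_supertask muE] := @supertask_measure_exists R C.
  by move=> n; case: (OC n).
exists mu => //; apply: muE.
under eq_fun do rewrite (OC _).2.
exact: cvg_truncn_fraction.
Qed.
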